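(* As $N\to\infty$, $$\frac1N\sum_{n=1}^{N}\log\frac{s(2n)}{2n}=\lambda+O\!\left(\frac{1}{\log N}\right),$$ where $$\lambda=\alpha(2)+\sum_{p\ \mathrm{prime}}\alpha(p)-\sum_{j\geq1}\frac1j\left((2\beta_j(2)-1)\prod_{p\geq3\ \mathrm{prime}}\beta_j(p)\right),$$ with, for a prime $p$ and an integer $j\geq1$, $$\alpha(p)=\left(1-\frac1p\right)\sum_{m\geq1}\frac{1}{p^m}\log\left(1+\frac1p+\cdots+\frac1{p^m}\right),\qquad \beta_j(p)=\left(1-\frac1p\right)\sum_{m\geq0}\frac{1}{p^m}\left(1+\frac1p+\cdots+\frac1{p^m}\right)^{-j}.$$
   Context: For an integer $n>1$, $s(n)=\sum_{d\mid n,\ d<n}d=\sigma(n)-n$, where $\sigma(n)=\sum_{d\mid n}d$. *)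

(* Defs.v *)
From Stdlib Require Import Reals ZArith Znumtheory List.
From Coquelicot Require Import Coquelicot.
Open Scope R_scope.

Definition sigma (n : nat) : nat :=
  fold_right Nat.add 0%nat
    (filter (fun d => Nat.eqb (Nat.modulo n d) 0) (seq 1 n)).

(* s(n) = sigma(n) - n  (sum of proper divisors); no truncation for n >= 1 *)
Definition s (n : nat) : nat := (sigma n - n)%nat.

Definition is_prime (p : nat) : Prop := prime (Z.of_nat p).
Definition is_prime_dec (p : nat) : {is_prime p} + {~ is_prime p} :=
  prime_dec (Z.of_nat p).

Definition geom (p m : nat) : R := sum_f_R0 (fun i => / (INR p) ^ i) m.

Definition alpha (p : nat) : R :=
  (1 - / INR p) *
  Series (fun k => / (INR p) ^ (S k) * ln (geom p (S k))).

Definition beta (j p : nat) : R :=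
  (1 - / INR p) *
  Series (fun m => / (INR p) ^ m * / (geom p m) ^ j).

Fixpoint odd_prime_prod (f : nat -> R) (N : nat) : R :=
  match N with
  | O => 1
  | S k => odd_prime_prod f k *
           (if is_prime_dec N then (if Nat.leb 3 N then f N else 1) else 1)
  end.

Definition odd_prime_product (f : nat -> R) : R :=
  real (Lim_seq (fun N => odd_prime_prod f N)).

Definition prime_sum (f : nat -> R) : R :=
  Series (fun n => if is_prime_dec n then f n else 0).

Definition lambda : R :=
  alpha 2 + prime_sum alpha -
  Series (fun k => / INR (S k) *
     ((2 * beta (S k) 2 - 1) * odd_prime_product (beta (S k)))).

Definition avg_log (N : nat) : R :=
  / INR N * sum_f_R0 (fun k => ln (INR (s (2 * (S k))) / INR (2 * (S k)))) (N - 1).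

(* Main.v *)
(* Put h(n) = sigma(n)/n, so that s(2n)/(2n) = h(2n) - 1 and h(2n) >= 3/2.

   Error term.  Let H_y(n) be the sum of 1/d over the d <= y dividing 2n.  It is
   periodic in n with period any common multiple L of 1, ..., y, and h(2n) - H_y(n)
   has mean O(1/y) over n <= N, uniformly in N.  As log(x - 1) is 2-Lipschitz on
   x >= 3/2, the mean of log(h(2n) - 1) over n <= N is within O(1/y + y L / N) of a
   constant P_y, and letting N tend to infinity in this bound gives
   lambda = P_y + O(1/y) as soon as the means are known to converge to lambda.
   One can take L <= 4^y when y is a power of 2, so y of order log N is allowed.

   Limit.  Write log(h - 1) = log h - sum_j h^(-j) / j.  The function log h(2n) is a
   sum, and h(2n)^(-j) a product, of functions of the valuations of n at the primes.
   If f is bounded, invariant under n -> p n and of mean m, then b(v_p(n)) f(n) has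
   mean m (1 - 1/p) sum_k b(k)/p^k, because the n <= N with v_p(n) >= k contribute
   to the sum of f as much as all the n <= N/p^k.  The passages from finitely many
   p, k, j to all of them are uniform in N. *)
From mathcomp Require all_boot zify.
From Stdlib Require Import Reals Lra Lia ZArith Znumtheory List.
From Coquelicot Require Import Coquelicot.
Require Import Defs.
Open Scope R_scope.

Module MeanValues.

Import all_boot zify.
Local Open Scope R_scope.

(** * Finite sums over 1, ..., n and their rearrangements *)

Fixpoint psum (f : nat -> R) (n : nat) : R :=
  match n with O => 0 | S k => psum f k + f (S k) end.

Lemma psum_ext f g n :
  (forall k, (0 < k <= n)%N -> f k = g k) -> psum f n = psum g n.
Proof.
elim: n => //= n IH H; rewrite IH ?H //; first lia.
by move=> k hk; apply: H; lia.
Qed.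

Lemma psum_le f g n :
  (forall k, (0 < k <= n)%N -> f k <= g k) -> psum f n <= psum g n.
Proof.
elim: n => /= [|n IH] H; first lra.
apply: Rplus_le_compat; last by apply: H; lia.
by apply: IH => k hk; apply: H; lia.
Qed.

Lemma psum_scal c f n : psum (fun k => c * f k) n = c * psum f n.
Proof. by elim: n => /= [|n ->]; ring. Qed.

Lemma psum_plus f g n : psum (fun k => f k + g k) n = psum f n + psum g n.
Proof. by elim: n => /= [|n ->]; ring. Qed.

Lemma psum_minus f g n : psum (fun k => f k - g k) n = psum f n - psum g n.
Proof. by elim: n => /= [|n ->]; ring. Qed.

Lemma psum_const c n : psum (fun _ => c) n = c * INR n.
Proof. by elim: n => [|n IH]; rewrite /psum -/psum ?IH ?S_INR /=; ring. Qed.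

Lemma psum_zero n : psum (fun _ => 0) n = 0.
Proof. by rewrite psum_const; ring. Qed.

Lemma psum_ge0 f n : (forall k, 0 <= f k) -> 0 <= psum f n.
Proof. by move=> H; rewrite -(psum_zero n); apply: psum_le. Qed.

Lemma psum_abs f c n :
  (forall k, (0 < k <= n)%N -> Rabs (f k) <= c) -> Rabs (psum f n) <= c * INR n.
Proof.
elim: n => [|n IH] H; first by rewrite /= Rabs_R0; lra.
rewrite S_INR /psum -/psum; apply: Rle_trans (Rabs_triang _ _) _.
have h1 : Rabs (psum f n) <= c * INR n by apply: IH => k hk; apply: H; lia.
have h2 : Rabs (f n.+1) <= c by apply: H; lia.
lra.
Qed.

Lemma psum_exchange (f : nat -> nat -> R) m n :
  psum (fun i => psum (f i) m) n = psum (fun j => psum (fun i => f i j) n) m.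
Proof.
elim: n => [|n IH] /=; first by rewrite psum_zero.
by rewrite IH -psum_plus.
Qed.

Lemma psum_add f m n : psum f (m + n) = psum f m + psum (fun k => f (m + k)%N) n.
Proof.
elim: n => [|n IH]; first by rewrite addn0 /=; ring.
by rewrite addnS /= IH addnS; ring.
Qed.

Lemma psum_mono f m n : (forall k, 0 <= f k) -> (m <= n)%N -> psum f m <= psum f n.
Proof.
move=> H /subnKC <-; rewrite psum_add.
have := psum_ge0 (fun k => f (m + k)%N) (n - m) (fun k => H _); lra.
Qed.

Lemma psum_multiples f p n : (0 < p)%N ->
  psum (fun d => if p %| d then f d else 0) n = psum (fun e => f (p * e)%N) (n %/ p).
Proof.
move=> p0; elim: n => [|n IH] /=; first by rewrite div0n.
rewrite IH divnS //; case: ifP => [pn|_]; last by rewrite add0n; ring.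
rewrite add1n /=; congr (_ + f _).
have -> : ((n %/ p).+1 = n.+1 %/ p)%N by rewrite divnS // pn.
by rewrite mulnC divnK.
Qed.

Lemma psum_single (c : R) k n :
  psum (fun e => if e == k then c else 0) n = if (0 < k <= n)%N then c else 0.
Proof.
elim: n => [|n IH] /=.
  by case: ifP => //; lia.
rewrite IH; case: eqP => [<-|h].
  by rewrite ltnn andbF ltnS leqnn /=; ring.
have -> : (0 < k <= n.+1)%N = (0 < k <= n)%N by lia.
ring.
Qed.

Lemma INR_pos n : (0 < n)%N -> 0 < INR n.
Proof. by move=> h; apply: lt_0_INR; lia. Qed.

Lemma INR_leq m n : (m <= n)%N -> INR m <= INR n.
Proof. by move=> h; apply: le_INR; lia. Qed.

Lemma INR_divn_le n d : (0 < d)%N -> INR (n %/ d) <= INR n / INR d.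
Proof.
move=> d0; have := INR_pos _ d0 => h.
apply: (Rmult_le_reg_r (INR d)) => //.
have -> : INR n / INR d * INR d = INR n by field; lra.
by rewrite -mult_INR; apply: INR_leq; apply: leq_trunc_div.
Qed.

(** * The abundancy index *)

Definition abund (n : nat) : R := psum (fun d => if d %| n then / INR d else 0) n.

(** A divisor of [n] is at most [n], so the added terms vanish. A range independent of [n] is what
    allows the sums over [n] and over divisors to be exchanged. *)
Lemma abund_ext n K : (0 < n <= K)%N ->
  abund n = psum (fun d => if d %| n then / INR d else 0) K.
Proof.
move=> /andP [n0 /subnKC <-]; rewrite psum_add /abund.
rewrite (psum_ext (fun k => if (n + k)%N %| n then _ else _) (fun _ => 0)).
  by rewrite psum_zero; ring.
move=> k hk; case: ifP => // /(dvdn_leq n0); lia.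
Qed.

Lemma abund_ge1 n : (0 < n)%N -> 1 <= abund n.
Proof.
move=> n0; apply: (Rle_trans _ (psum (fun d => if d %| n then / INR d else 0) 1)).
  by rewrite /= dvd1n Rinv_1; lra.
(* [psum_mono] asks for a nonnegative term at index 0 as well, where [/ INR 0] is 0. *)
apply: psum_mono => // -[|k]; case: ifP => _; try lra.
  by rewrite /= Rinv_0; lra.
by apply: Rlt_le; apply: Rinv_0_lt_compat; apply: INR_pos.
Qed.

Lemma psum_seq (P : nat -> bool) n :
  INR (fold_right Nat.add 0%nat (List.filter P (List.seq 1 n))) =
  psum (fun d => if P d then INR d else 0) n.
Proof.
elim: n => // n IH.
rewrite List.seq_S List.filter_app List.fold_right_app /psum -/psum -IH /=.
have H l a : fold_right Nat.add a l = (fold_right Nat.add 0%nat l + a)%N.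
  by elim: l => //= b l ->; lia.
case: (P n.+1) => /=; last by rewrite Rplus_0_r.
by rewrite H -[addn]/Nat.add plus_INR; case: (n) => //= m; rewrite Nat.add_0_r.
Qed.

Lemma modn_eqb n d : (0 < d)%N -> Nat.eqb (Nat.modulo n d) 0 = (d %| n).
Proof.
move=> d0; rewrite /dvdn.
have -> : Nat.modulo n d = n %% d.
  apply/esym/(Nat.mod_unique _ _ (n %/ d)); first by apply/ltP; rewrite ltn_mod.
  by rewrite {1}(divn_eq n d) mulnC.
by apply/idP/idP => [/PeanoNat.Nat.eqb_spec ->|/eqP ->].
Qed.

(** Double counting of the pairs with d e = n, each weighted by d: summing over e first gives
    sigma(n), summing over d first gives the sum of n/e over the divisors e. *)
Lemma sigma_abund n : (0 < n)%N -> INR (sigma n) = INR n * abund n.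
Proof.
move=> n0; rewrite /sigma psum_seq /abund -psum_scal.
pose F d e := if (d * e)%N == n then INR d else 0.
transitivity (psum (fun d => psum (F d) n) n).
  apply: psum_ext => d hd; rewrite modn_eqb; last lia.
  case: ifP => dn.
    rewrite (psum_ext (F d) (fun e => if e == n %/ d then INR d else 0)).
      by rewrite psum_single ifT // leq_div andbT divn_gt0 ?(dvdn_leq n0 dn) //; case/andP: hd.
    by move=> k hk; rewrite /F eqn_div // 1?mulnC //; case/andP: hd.
  rewrite (psum_ext (F d) (fun=> 0)) ?psum_zero // => k hk.
  by rewrite /F; case: eqP => // E; rewrite -E dvdn_mulr in dn.
rewrite psum_exchange; apply: psum_ext => e he.
case: ifP => dn.
  rewrite (psum_ext _ (fun d => if d == n %/ e then INR (n %/ e) else 0)).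
    rewrite psum_single ifT; last first.
      by rewrite leq_div andbT divn_gt0 ?(dvdn_leq n0 dn) //; case/andP: he.
    have e0 : 0 < INR e by apply: INR_pos; lia.
    by rewrite -{2}(divnK dn) mult_INR; field; lra.
  have e0 : (0 < e)%N by case/andP: he.
  by move=> k hk; rewrite /F eqn_div //; case: eqP => // <-; rewrite mulnK.
rewrite (psum_ext _ (fun=> 0)) ?psum_zero ?Rmult_0_r // => k hk.
by rewrite /F; case: eqP => // E; rewrite -E dvdn_mull in dn.
Qed.

Lemma s_abund n : (0 < n)%N -> INR (s n) / INR n = abund n - 1.
Proof.
move=> n0; have nR := INR_pos _ n0; rewrite /s minus_INR.
  by rewrite sigma_abund //; field; lra.
(* The subtraction in [s] does not truncate: h(n) >= 1 means n <= sigma(n). *)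
apply: INR_le; rewrite sigma_abund //; have := abund_ge1 _ n0; nra.
Qed.

(** The divisors of p n that are multiples of p are the p d with d dividing n, which contribute
    h(n)/p. The others are prime to p, hence are the divisors of the part of n prime to p. *)
Lemma abund_primeM p n : prime p -> (0 < n)%N ->
  abund (p * n)%N = / INR p * abund n + abund (n`_p^')%N.
Proof.
move=> pp n0; have p0 := prime_gt0 pp.
rewrite {1}/abund (psum_ext _ (fun d => (if p %| d then (if d %| p * n then / INR d else 0) else 0)
   + (if d %| n`_p^' then / INR d else 0))).
  rewrite psum_plus (psum_multiples (fun d => if d %| _ then _ else _)) // mulKn //.
  congr (_ + _).
    rewrite /abund -psum_scal; apply: psum_ext => k hk.
    rewrite dvdn_pmul2l //; case: ifP => _; last ring.
    by rewrite mult_INR Rinv_mult.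
  rewrite -abund_ext // part_gt0 /=.
  apply: leq_trans (dvdn_leq n0 (dvdn_part _ _)) _.
  by rewrite leq_pmull.
move=> d hd.
have pn : (p^').-nat n`_p^' by apply: part_pnat.
case pd: (p %| d).
  suff -> : (d %| n`_p^') = false by ring.
  apply/negP => /(dvdn_trans pd) h.
  have := pnat_dvd h pn; rewrite pnatE // !inE eqxx //.
suff -> : (d %| p * n) = (d %| n`_p^') by ring.
apply/idP/idP => [h|h]; last first.
  by apply: dvdn_trans h _; apply: dvdn_mull; apply: dvdn_part.
have cd : coprime d (p * n`_p).
  rewrite coprimeMr (coprime_sym d p) prime_coprime // pd /=.
  rewrite p_part; apply: coprimeXr.
  by rewrite coprime_sym prime_coprime // pd.
by rewrite -(Gauss_dvdr _ cd) -mulnA partnC.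
Qed.

(** Splitting off the first term instead of the last gives the recursion that [abund_primeM] gives
    for h. *)
Lemma geomS p m : geom p m.+1 = 1 + / INR p * geom p m.
Proof.
elim: m => [|m IH]; first by rewrite /geom /= Rmult_1_r Rinv_1 Rmult_1_r.
have E k : geom p k.+1 = geom p k + / INR p ^ k.+1 by [].
by rewrite E {1}IH E -tech_pow_Rmult Rinv_mult; ring.
Qed.

Lemma geom0 p : geom p 0 = 1.
Proof. by rewrite /geom /= Rinv_1. Qed.

Lemma abund_prime_power p k m : prime p -> (0 < m)%N -> ~~ (p %| m) ->
  abund (p ^ k * m)%N = geom p k * abund m.
Proof.
move=> pp m0 pm; elim: k => [|k IH].
  by rewrite expn0 mul1n geom0; ring.
have p0 := prime_gt0 pp.
rewrite expnS -mulnA abund_primeM //; last by rewrite muln_gt0 expn_gt0 p0.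
rewrite IH geomS.
suff -> : ((p ^ k * m)`_p^' = m)%N by ring.
rewrite partnM ?expn_gt0 ?p0 //.
rewrite part_p'nat; last by rewrite pnatNK pnatX pnat_id.
rewrite mul1n part_pnat_id // p'natE //.
Qed.

Lemma logn_nonprime p n : ~~ prime p -> logn p n = 0%N.
Proof. by move=> /negbTE h; rewrite lognE h. Qed.

(* When [p] is not prime, [logn p n = 0], so the sums of [lfac p n] over all [p]
   are sums over primes. *)
Definition lfac (p n : nat) : R := ln (geom p (logn p n)).

Lemma logn_not_dvd p n : ~~ (p %| n) -> logn p n = 0%N.
Proof. by move=> /negbTE h; rewrite lognE h !andbF. Qed.

Lemma lfac_coprime p n : ~~ (p %| n) -> lfac p n = 0.
Proof. by move=> h; rewrite /lfac logn_not_dvd // geom0 ln_1. Qed.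

Lemma lfac_nonprime p n : ~~ prime p -> lfac p n = 0.
Proof. by move=> /negbTE h; rewrite /lfac logn_nonprime ?h // geom0 ln_1. Qed.

Lemma geom_ge1 p m : (0 < p)%N -> 1 <= geom p m.
Proof.
move=> p0; elim: m => [|m IH]; first by rewrite geom0; lra.
rewrite geomS; have := Rinv_0_lt_compat _ (INR_pos _ p0); nra.
Qed.

Lemma geom_le p m : (1 < p)%N -> geom p m <= 1 + 2 / INR p.
Proof.
move=> p1; have p2 : 2 <= INR p by apply: (INR_leq 2).
have ip : 0 < / INR p by apply: Rinv_0_lt_compat; lra.
have ip1 : / INR p * INR p = 1 by field; lra.
elim: m => [|m IH]; first by rewrite geom0 /Rdiv; lra.
rewrite geomS /Rdiv; have h : / INR p * geom p m <= / INR p * (1 + 2 / INR p).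
  by apply: Rmult_le_compat_l; lra.
by rewrite /Rdiv in h IH *; nra.
Qed.

Lemma lfac_ge0 p n : 0 <= lfac p n.
Proof.
case pp: (prime p); last by rewrite lfac_nonprime ?pp //; lra.
have p0 := prime_gt0 pp; have h := geom_ge1 p (logn p n) p0.
by rewrite /lfac -ln_1; apply: ln_le; [lra|exact: h].
Qed.

Lemma ln_le_minus1 x : 0 < x -> ln x <= x - 1.
Proof.
move=> x0; have := exp_ineq1_le (ln x); rewrite exp_ln //; lra.
Qed.

Lemma ln_geom_le p m : (1 < p)%N -> ln (geom p m) <= 2 / INR p.
Proof.
move=> p1; have := geom_ge1 p m (ltnW p1); have := geom_le p m p1.
by have := ln_le_minus1 (geom p m); lra.
Qed.

(** The bound has the shape of the terms of [mean_tail_le], with [c] equal to 2 and p running over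
    all integers. *)
Lemma lfac_le p n : (0 < p)%N -> lfac p n <= (if p %| n then 2 / INR p else 0).
Proof.
move=> p0; case: ifP => h; last by rewrite lfac_coprime ?h //; lra.
case: (ltnP 1 p) => hp; first exact: ln_geom_le.
rewrite lfac_nonprime; last by apply/negP => /prime_gt1; lia.
by apply: Rlt_le; apply: Rdiv_lt_0_compat; [lra|apply: INR_pos].
Qed.

(** Induction on K strips off the power of the prime K + 1. The hypothesis bounds the prime factors
    rather than n because this is what passes from K + 1 to K when K + 1 is composite. *)
Lemma ln_abund_smooth K n : (0 < n)%N ->
  (forall p, prime p -> p %| n -> (p <= K)%N) ->
  ln (abund n) = psum (fun p => lfac p n) K.
Proof.
elim: K n => [|K IH] n n0 H.
  have -> : n = 1%N.
    apply/eqP; rewrite eqn_leq n0 andbT leqNgt; apply/negP => n1.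
    have := H _ (pdiv_prime n1) (pdiv_dvd n).
    by have := prime_gt0 (pdiv_prime n1); lia.
  by rewrite /abund /= Rplus_0_l Rinv_1 ln_1.
rewrite /psum -/psum; case pK: (prime K.+1); last first.
  rewrite lfac_nonprime ?pK // Rplus_0_r; apply: IH => // p pp pn.
  have := H p pp pn; rewrite leq_eqVlt => /orP [/eqP E|//].
  by rewrite -E pp in pK.
set q := K.+1 in pK *.
have [m qm En] := pfactor_coprime pK n0.
have m0 : (0 < m)%N by move: n0; rewrite En muln_gt0 => /andP [].
have nqm : ~~ (q %| m) by rewrite -prime_coprime.
have h1 := abund_ge1 m m0; have h2 := geom_ge1 q (logn q n) isT.
rewrite {1}En mulnC abund_prime_power // ln_mult; try lra.
rewrite Rplus_comm -/(lfac q n); congr (_ + _).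
rewrite (IH m) //.
  apply: psum_ext => p hp; rewrite /lfac; congr (ln (geom p _)).
  case pp: (prime p); last by rewrite !logn_nonprime ?pp.
  rewrite {1}En lognM ?expn_gt0 // lognX (@logn_prime p q) //.
  have -> : (p == q) = false by rewrite /q; lia.
  by rewrite muln0 addn0.
move=> p pp pm; have : (p <= q)%N by apply: H => //; rewrite En dvdn_mulr.
rewrite leq_eqVlt => /orP [/eqP E|//].
by rewrite -E pm in nqm.
Qed.

Lemma ln_abund n K : (0 < n <= K)%N -> ln (abund n) = psum (fun p => lfac p n) K.
Proof.
move=> /andP [n0 nK]; apply: ln_abund_smooth => // p _ /(dvdn_leq n0) h.
exact: leq_trans h nK.
Qed.

(** * The error term *)

(** By Legendre, the exponent of p in the binomial coefficient is the sum over i of floor(2n/p^i) -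
    2 floor(n/p^i). All terms are nonnegative, and the term i = k is positive. *)
Lemma prime_dvd_bin p k n : prime p -> (n < p ^ k <= n.*2)%N -> p %| 'C(n.*2, n).
Proof.
move=> pp /andP [h1 h2].
have C0 : (0 < 'C(n.*2, n))%N by rewrite bin_gt0; lia.
have k0 : (0 < k)%N by case: k h1 h2 => // h1 h2; move: h1 h2; rewrite expn0; lia.
have lt_i i : (i < p ^ i)%N by apply: ltn_expl; apply: prime_gt1.
have k2n : (k <= n.*2)%N by apply: leq_trans (ltnW (lt_i k)) h2.
have E := bin_fact (n := n.*2) (m := n) ltac:(lia).
have {E} : (logn p 'C(n.*2, n) + (logn p n`! + logn p n`!) = logn p (n.*2)`!)%N.
  rewrite -E (_ : (n.*2 - n)%N = n); last lia.
  by rewrite !lognM // ?muln_gt0 ?fact_gt0.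
rewrite !logn_fact //.
(* Both Legendre sums get the same range, to be compared termwise; the new terms vanish since p^i >
   i > n. *)
have -> : (\sum_(1 <= i < n.+1) n %/ p ^ i = \sum_(1 <= i < n.*2.+1) n %/ p ^ i)%N.
  rewrite [RHS](big_cat_nat _ (n := n.+1)) /=; [|lia|lia].
  rewrite [X in (_ + X)%N]big_nat_cond [X in (_ + X)%N]big1 ?addn0 // => i; rewrite andbT => hi.
  by apply: divn_small; apply: leq_trans (ltnW (lt_i _)); lia.
rewrite -big_split /= => E.
suff : (0 < logn p 'C(n.*2, n))%N by rewrite logn_gt0 mem_primes => /and3P [].
rewrite lt0n; apply/negP => /eqP Z; move: E; rewrite Z add0n.
have kin : k \in index_iota 1 n.*2.+1 by rewrite mem_index_iota; lia.
rewrite !(bigD1_seq k) ?iota_uniq //= divn_small // !add0n.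
have : (1 <= n.*2 %/ p ^ k)%N by rewrite divn_gt0 //; lia.
have : (\sum_(1 <= i < n.*2.+1 | i != k) (n %/ p ^ i + n %/ p ^ i) <=
        \sum_(1 <= i < n.*2.+1 | i != k) n.*2 %/ p ^ i)%N.
  apply: leq_sum => i _; rewrite addnn leq_divRL ?expn_gt0 ?prime_gt0 //.
  by rewrite -doubleMl leq_double leq_trunc_div.
lia.
Qed.

(* Since the prime powers in [(n, 2n]] enter the binomial coefficient with
   exponent one, it supplies what a common multiple of [1..n] lacks. *)
Lemma dvd_bin_common_multiple n L : (0 < L)%N ->
  (forall d, (0 < d <= n)%N -> d %| L) ->
  forall d, (0 < d <= n.*2)%N -> d %| ('C(n.*2, n) * L)%N.
Proof.
move=> L0 H d /andP [d0 dn]; apply/(dvdn_partP _ d0) => p pd.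
have pp : prime p by move: pd; rewrite mem_primes => /andP [].
have k0 : (0 < logn p d)%N by rewrite logn_gt0.
rewrite p_part; set k := logn p d in k0 *.
have kd : (p ^ k <= n.*2)%N.
  by apply: leq_trans dn; apply: dvdn_leq => //; apply: pfactor_dvdnn.
case: (leqP (p ^ k) n) => hk.
  by apply: dvdn_mull; apply: H; rewrite expn_gt0 prime_gt0 // hk.
(* As p >= 2, p^(k-1) is at most n and divides [L]; the binomial coefficient supplies the last
   factor p. *)
move: kd hk; rewrite -(prednK k0) => kd hk; rewrite expnS; apply: dvdn_mul.
  by apply: (prime_dvd_bin _ k.-1.+1) => //; rewrite hk.
apply: H; rewrite expn_gt0 prime_gt0 //=; rewrite expnS in kd.
have := prime_gt1 pp; nia.
Qed.

Lemma bin_double_le n : ('C(n.*2, n) <= 4 ^ n)%N.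
Proof.
rewrite -[4%N]/(2 ^ 2)%N -expnM mul2n -[2%N]/(1 + 1)%N expnDn.
have hn : (n < n.*2.+1)%N by lia.
rewrite (bigD1 (Ordinal hn)) //= !exp1n !muln1.
exact: leq_addr.
Qed.

(** Each doubling of the range costs a binomial coefficient of size at most 4^(2^t), which squares
    the bound. The cruder choice of a factorial would only allow y of order log N / log log N. *)
Lemma common_multiple t : exists L, (0 < L <= 4 ^ (2 ^ t))%N /\
  forall d, (0 < d <= 2 ^ t)%N -> d %| L.
Proof.
elim: t => [|t [L [/andP [L0 L1] H]]].
  by exists 1%N; split => // -[|[|d]].
exists ('C((2 ^ t).*2, 2 ^ t) * L)%N; rewrite expnS mul2n; split.
  rewrite muln_gt0 bin_gt0 L0 -addnn leq_addr /= expnD.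
  by rewrite leq_mul // addnn bin_double_le.
exact: dvd_bin_common_multiple.
Qed.

Lemma psum_abs_le f n : Rabs (psum f n) <= psum (fun k => Rabs (f k)) n.
Proof.
elim: n => [|n IH] /=; first by rewrite Rabs_R0; lra.
by apply: Rle_trans (Rabs_triang _ _) _; lra.
Qed.

Lemma psum_periodic f L q r : (forall n, f (L + n)%N = f n) ->
  psum f (q * L + r) = INR q * psum f L + psum f r.
Proof.
move=> H; elim: q => [|q IH]; first by rewrite mul0n add0n /=; ring.
rewrite mulSn -addnA psum_add (psum_ext (fun k => f (L + k)%N) f) // IH S_INR; ring.
Qed.

(** With N = q L + r, the difference is (S(r) - (r/L) S(L)) / N, where S is the summatory function
    of [f]; both terms in the numerator are at most B L. *)
Lemma mean_periodic f L B N : (0 < L)%N -> (0 < N)%N -> (forall n, f (L + n)%N = f n) ->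
  (forall n, Rabs (f n) <= B) ->
  Rabs (psum f N / INR N - psum f L / INR L) <= 2 * B * INR L / INR N.
Proof.
move=> L0 N0 per bd; have LR := INR_pos _ L0; have NR := INR_pos _ N0.
have B0 : 0 <= B by apply: Rle_trans (bd 0%N); apply: Rabs_pos.
have rL : (N %% L < L)%N by rewrite ltn_mod.
have EN : INR N = INR (N %/ L) * INR L + INR (N %% L).
  by rewrite {1}(divn_eq N L) plus_INR mult_INR.
have ES := psum_periodic f L (N %/ L) (N %% L) per; rewrite -divn_eq in ES.
have hr : Rabs (psum f (N %% L)) <= B * INR L.
  apply: Rle_trans (psum_abs f B _ _) _ => //; apply: Rmult_le_compat_l => //.
  by apply: INR_leq; apply: ltnW.
have hL : Rabs (psum f L) <= B * INR L by apply: psum_abs.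
have r1 : INR (N %% L) / INR L <= 1.
  apply: (Rmult_le_reg_r (INR L)) => //; rewrite /Rdiv Rmult_assoc Rinv_l; last lra.
  by have := INR_leq _ _ (ltnW rL); lra.
have r0 : 0 <= INR (N %% L) / INR L.
  by apply: Rmult_le_pos (pos_INR _) _; apply: Rlt_le; apply: Rinv_0_lt_compat.
have -> : psum f N / INR N - psum f L / INR L =
  (psum f (N %% L) - INR (N %% L) / INR L * psum f L) * / INR N.
  have -> : psum f N = (INR N - INR (N %% L)) / INR L * psum f L + psum f (N %% L).
    by rewrite ES EN; field; lra.
  by field; lra.
rewrite Rabs_mult (Rabs_right (/ INR N)); last first.
  by apply: Rle_ge; apply: Rlt_le; apply: Rinv_0_lt_compat.
rewrite /Rdiv; apply: Rmult_le_compat_r; first by apply: Rlt_le; apply: Rinv_0_lt_compat.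
apply: Rle_trans (Rabs_triang _ _) _; rewrite Rabs_Ropp Rabs_mult (Rabs_right (_ / _)); last lra.
have := Rmult_le_compat_r _ _ _ (Rabs_pos (psum f L)) r1; lra.
Qed.

Lemma psum_even_le f N : (forall k, 0 <= f k) ->
  psum (fun n => f (2 * n)%N) N <= psum f (2 * N).
Proof.
move=> f0; elim: N => [|N IH]; first by rewrite muln0 /=; lra.
rewrite mulnS add2n /=; rewrite mulnS add2n; have := f0 (2 * N).+1; lra.
Qed.

(** Counting the multiples of [d] among all integers up to 2N avoids distinguishing the parity of
    [d]. *)
Lemma count_even_multiples d N : (0 < d)%N ->
  psum (fun n => if d %| (2 * n)%N then 1 else 0) N <= 2 * INR N / INR d.
Proof.
move=> d0; apply: Rle_trans (psum_even_le (fun n => if d %| n then 1 else 0) N _) _.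
  by move=> k; case: ifP => _; lra.
rewrite (psum_multiples (fun=> 1)) // psum_const Rmult_1_l.
by apply: Rle_trans (INR_divn_le _ _ d0) _; rewrite mult_INR; simpl (INR 2); lra.
Qed.

Lemma sum_inv_sq_tail y K : (0 < y)%N ->
  psum (fun k => / (INR (y + k)) ^ 2) K <= / INR y - / INR (y + K).
Proof.
move=> y0; elim: K => [|K IH]; first by rewrite addn0 /=; lra.
rewrite /psum -/psum !addnS S_INR.
have h : 0 < INR (y + K) by apply: INR_pos; lia.
have yR := INR_pos _ y0.
have -> : / INR y - / (INR (y + K) + 1) =
  (/ INR y - / INR (y + K)) + / (INR (y + K) * (INR (y + K) + 1)) by field; lra.
apply: Rplus_le_compat IH _; apply: Rinv_le_contravar; nra.
Qed.

(** After exchanging the sums, d = y + k contributes at most (c/d)(2N/d), and the sum of 1/d^2 over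
    d > y is at most 1/y. This serves both for the divisors above y and for the primes above K. *)
Lemma mean_tail_le c y K N : 0 <= c -> (0 < y)%N -> (0 < N)%N ->
  psum (fun n => psum (fun k => if (y + k)%N %| (2 * n)%N then c / INR (y + k) else 0) K) N
    <= 2 * c / INR y * INR N.
Proof.
move=> c0 y0 N0; rewrite psum_exchange.
have NR := INR_pos _ N0; have yR := INR_pos _ y0.
apply: (Rle_trans _ (psum (fun k => 2 * c * INR N * / (INR (y + k)) ^ 2) K)).
  apply: psum_le => k hk.
  have d0 : (0 < y + k)%N by lia.
  have dR := INR_pos _ d0.
  rewrite (psum_ext _ (fun n => c / INR (y + k) * (if (y + k)%N %| (2 * n)%N then 1 else 0))).
    rewrite psum_scal; have := count_even_multiples _ N d0 => h.
    apply: Rle_trans (Rmult_le_compat_l (c / INR (y + k)) _ _ _ h) _.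
      by apply: Rmult_le_pos => //; apply: Rlt_le; apply: Rinv_0_lt_compat.
    by apply: Req_le; field; lra.
  by move=> n hn; case: ifP => _; ring.
rewrite psum_scal; have h := sum_inv_sq_tail y K y0.
have h2 : 0 < / INR (y + K) by apply: Rinv_0_lt_compat; apply: INR_pos; lia.
have -> : 2 * c / INR y * INR N = 2 * c * INR N * / INR y by field; lra.
apply: Rmult_le_compat_l; last lra.
by apply: Rmult_le_pos; lra.
Qed.

Lemma ln_shift_lipschitz a b : 3/2 <= a -> 3/2 <= b ->
  Rabs (ln (a - 1) - ln (b - 1)) <= 2 * Rabs (a - b).
Proof.
have H u v : 3/2 <= v -> v <= u -> Rabs (ln (u - 1) - ln (v - 1)) <= 2 * Rabs (u - v).
  move=> hv huv; rewrite !Rabs_right; try lra; last first.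
    have := ln_le (v - 1) (u - 1) ltac:(lra) ltac:(lra); lra.
  rewrite -ln_div; try lra.
  have := ln_le_minus1 ((u - 1) / (v - 1)) ltac:(apply: Rdiv_lt_0_compat; lra).
  have -> : (u - 1) / (v - 1) - 1 = (u - v) * / (v - 1) by field; lra.
  have : / (v - 1) <= / (1/2) by apply: Rinv_le_contravar; lra.
  nra.
move=> ha hb; case: (Rle_dec a b) => hab; last by apply: H; lra.
by rewrite Rabs_minus_sym (Rabs_minus_sym a b); apply: H.
Qed.

(* Unlike [abund (2 * n)], this is periodic in [n]. *)
Definition abund2_trunc (y n : nat) : R :=
  psum (fun d => if d %| (2 * n)%N then / INR d else 0) y.

Lemma term_ge0 d m : 0 <= (if d %| m then / INR d else 0).
Proof.
case: ifP => _; last lra.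
by case: d => [|d]; [rewrite /= Rinv_0; lra|apply: Rlt_le; apply: Rinv_0_lt_compat; apply: INR_pos].
Qed.

(** The divisors 1 and 2 of 2n already contribute 3/2. *)
Lemma abund2_trunc_ge y n : (1 < y)%N -> 3/2 <= abund2_trunc y n.
Proof.
move=> y1; apply: (Rle_trans _ (abund2_trunc 2 n)).
  by rewrite /abund2_trunc /psum dvd1n dvdn_mulr // Rinv_1 /=; lra.
by apply: psum_mono y1 => k; apply: term_ge0.
Qed.

Lemma abund2_trunc_le y n : abund2_trunc y n <= INR y.
Proof.
rewrite -[INR y]Rmult_1_l -psum_const; apply: psum_le => d hd; case: ifP => _; last lra.
rewrite -Rinv_1; apply: Rinv_le_contravar; first lra.
by apply: (INR_leq 1); case/andP: hd.
Qed.

Lemma abund_even_ge n : (0 < n)%N -> 3/2 <= abund (2 * n)%N.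
Proof. by move=> n0; apply: (abund2_trunc_ge (2 * n) n); lia. Qed.

(** [P] is the mean of log(H_y - 1) over one period. The error 4/y is the Lipschitz constant 2 times
    the bound 2/y for the mean tail; the other term is [mean_periodic] with |log(H_y - 1)| <= y. *)
Lemma mean_near_constant y L : (1 < y)%N -> (0 < L)%N ->
  (forall d, (0 < d <= y)%N -> d %| L) ->
  exists P, forall N, (0 < N)%N ->
  Rabs (psum (fun n => ln (abund (2 * n)%N - 1)) N / INR N - P)
    <= 4 / INR y + 2 * INR y * INR L / INR N.
Proof.
move=> y1 L0 HL.
pose g n := ln (abund2_trunc y n - 1).
have yR : 2 <= INR y by apply: (INR_leq 2).
have per n : g (L + n)%N = g n.
  rewrite /g; congr (ln (_ - 1)); apply: psum_ext => d hd.
  by rewrite mulnDr dvdn_addr // dvdn_mull // HL.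
have bd n : Rabs (g n) <= INR y.
  have h1 := abund2_trunc_ge y n y1; have h2 := abund2_trunc_le y n.
  apply: Rabs_le; split.
    (* For u >= 1/2, -log u = log(1/u) <= 1/u - 1 <= 1. *)
    have := ln_le_minus1 (/ (abund2_trunc y n - 1)) ltac:(apply: Rinv_0_lt_compat; lra).
    rewrite ln_Rinv -/(g n); last lra.
    have : / (abund2_trunc y n - 1) <= / (1/2) by apply: Rinv_le_contravar; lra.
    lra.
  by have := ln_le_minus1 (abund2_trunc y n - 1) ltac:(lra); rewrite -/(g n); lra.
exists (psum g L / INR L) => N N0; have NR := INR_pos _ N0.
have h1 := mean_periodic g L (INR y) N L0 N0 per bd.
suff h2 : Rabs (psum (fun n => ln (abund (2 * n)%N - 1)) N / INR N - psum g N / INR N) <= 4 / INR y.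
  by move: h1 h2; split_Rabs; lra.
rewrite /Rdiv -Rmult_minus_distr_r -psum_minus Rabs_mult.
rewrite (Rabs_right (/ INR N)); last first.
  by apply: Rle_ge; apply: Rlt_le; apply: Rinv_0_lt_compat.
apply: (Rmult_le_reg_r (INR N)) => //; rewrite Rmult_assoc Rinv_l; last lra.
rewrite Rmult_1_r.
apply: Rle_trans (psum_abs_le _ _) _.
apply: (Rle_trans _ (2 * 2 / INR y * INR N)); last by apply: Req_le; rewrite /Rdiv; ring.
apply: Rle_trans (mean_tail_le 2 y (2 * N) N ltac:(lra) ltac:(lia) N0).
apply: psum_le => n hn.
have n0 : (0 < n)%N by case/andP: hn.
apply: Rle_trans (ln_shift_lipschitz _ _ (abund_even_ge n n0) (abund2_trunc_ge y n y1)) _.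
rewrite (abund_ext _ (y + 2 * N)); last lia.
rewrite psum_add /abund2_trunc Rplus_minus_l Rabs_right; last first.
  by apply: Rle_ge; apply: psum_ge0 => k; apply: term_ge0.
rewrite -psum_scal; apply: psum_le => k hk; case: ifP => _; first by apply: Req_le.
lra.
Qed.

(** * Mean values of functions of valuations *)

Lemma is_lim_seq_bound (u : nat -> R) (l a c : R) :
  is_lim_seq u l -> (forall n, Rabs (u n - a) <= c) -> Rabs (l - a) <= c.
Proof.
move=> ul H.
apply: (is_lim_seq_le (fun n => Rabs (u n - a)) (fun=> c) (Rabs (l - a)) c H).
  exact: (is_lim_seq_abs _ _ (is_lim_seq_minus' _ _ _ _ ul (is_lim_seq_const a))).
exact: is_lim_seq_const.
Qed.

(** The common tool for passing from finitely many p, k or j to all of them. Since |v_K - v_K'| <=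
    e_K + e_K', [v] is Cauchy, so the convergence of the series or product under study comes out
    together with the mean value. *)
Lemma moore_osgood (u : nat -> R) (w : nat -> nat -> R) (v e : nat -> R) :
  (forall K N, Rabs (u N - w K N) <= e K) -> is_lim_seq e 0 ->
  (forall K, is_lim_seq (w K) (v K)) ->
  exists V : R, is_lim_seq v V /\ is_lim_seq u V.
Proof.
move=> H e0 wv.
have He eps : 0 < eps -> exists M, forall K, (M <= K)%coq_nat -> e K < eps.
  move=> eps0; move/is_lim_seq_spec: e0 => /(_ (mkposreal _ eps0)) [M HM].
  by exists M => K /HM /=; rewrite Rminus_0_r => /Rabs_def2; lra.
have Hvv K K' : Rabs (v K - v K') <= e K + e K'.
  have : is_lim_seq (fun N => w K N - w K' N) (v K - v K') by apply: is_lim_seq_minus'.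
  move=> hw; rewrite -[v K - v K']Rminus_0_r; apply: (is_lim_seq_bound _ _ _ _ hw) => N.
  rewrite Rminus_0_r; have := H K N; have := H K' N; split_Rabs; lra.
have : ex_lim_seq_cauchy v.
  move=> eps; have [M HM] := He (eps / 2) ltac:(case: eps => x x0 /=; lra).
  exists M => m n /HM hm /HM hn; have := Hvv n m; have := Hvv m n; lra.
move/ex_lim_seq_cauchy_corr => [V vV]; exists V; split => //.
have HV K : Rabs (V - v K) <= e K.
  apply: le_epsilon => eps eps0.
  have [M HM] := He eps eps0.
  apply: (is_lim_seq_bound (fun n => v (n + M)%coq_nat)).
    by rewrite -is_lim_seq_incr_n.
  by move=> n; have := Hvv (n + M)%coq_nat K; have := HM (n + M)%coq_nat ltac:(lia); lra.
apply/is_lim_seq_spec => eps; have [M HM] := He (eps / 3) ltac:(case: eps => x x0 /=; lra).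
move: (wv M) => /is_lim_seq_spec /(_ (mkposreal (eps / 3) ltac:(case: eps {HM} => x x0 /=; lra))) [N0 /= HN].
exists N0 => N /HN h; have := HV M; have := H M N; have := HM M (le_n M).
by move: h; split_Rabs; lra.
Qed.

Lemma INR_expn p k : INR (p ^ k) = INR p ^ k.
Proof.
by elim: k => // k IH; rewrite expnS mult_INR IH.
Qed.

Lemma psum_shift f K : psum f K.+1 = f 1%N + psum (fun k => f k.+1) K.
Proof. by rewrite -[K.+1]add1n psum_add {1}/psum Rplus_0_l. Qed.

Lemma sum_n_psum (a : nat -> R) K : sum_n a K = psum (fun k => a k.-1) K.+1.
Proof.
elim: K => [|K IH]; first by rewrite sum_O /=; ring.
by rewrite sum_Sn IH.
Qed.

Lemma is_lim_seq_Series (a : nat -> R) (V : R) :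
  is_lim_seq (sum_n a) V -> Series a = V.
Proof. by move=> h; apply: is_series_unique; exact: h. Qed.

Lemma Series_psum (a : nat -> R) (V : R) :
  is_lim_seq (fun K => psum (fun k => a k.-1) K) V -> Series a = V.
Proof.
move=> /is_lim_seq_incr_1 h; apply: is_lim_seq_Series.
by apply: is_lim_seq_ext h => K; rewrite sum_n_psum.
Qed.

Lemma is_lim_seq_psum (F : nat -> nat -> R) (v : nat -> R) K :
  (forall k, (0 < k)%N -> is_lim_seq (F k) (v k)) ->
  is_lim_seq (fun N => psum (fun k => F k N) K) (psum v K).
Proof.
move=> H; elim: K => [|K IH]; first exact: is_lim_seq_const.
by apply: is_lim_seq_plus' => //; apply: H.
Qed.

Definition mean (f : nat -> R) (N : nat) : R := psum f N / INR N.

Definition has_mean (f : nat -> R) (m : R) : Prop := is_lim_seq (mean f) m.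

Lemma has_mean_ext f g m :
  (forall n, (0 < n)%N -> f n = g n) -> has_mean f m -> has_mean g m.
Proof.
move=> H; apply: is_lim_seq_ext => N; congr (_ / _); apply: psum_ext => k hk.
by apply: H; case/andP: hk.
Qed.

Lemma has_mean_cst c : has_mean (fun=> c) c.
Proof.
apply: (is_lim_seq_ext_loc (fun=> c)); last exact: is_lim_seq_const.
exists 1%N => N hN; rewrite /mean psum_const; field.
by have := INR_pos N ltac:(lia); lra.
Qed.

Lemma is_lim_seq_divn d : (0 < d)%N ->
  is_lim_seq (fun N => INR (N %/ d) / INR N) (/ INR d).
Proof.
move=> d0; have dR := INR_pos _ d0.
have h0 : is_lim_seq (fun N => / INR d - / INR N) (/ INR d).
  rewrite -{2}[/ INR d]Rminus_0_r; apply: is_lim_seq_minus'.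
    exact: is_lim_seq_const.
  by apply: (is_lim_seq_inv INR p_infty) => //; apply: is_lim_seq_INR.
apply: (is_lim_seq_le_le_loc _ _ _ _ _ h0 (is_lim_seq_const _)).
exists 1%N => N hN; have NR := INR_pos N ltac:(lia).
have h1 := INR_divn_le N d d0.
have h2 : INR N <= (INR (N %/ d) + 1) * INR d.
  rewrite -S_INR -mult_INR; apply: INR_leq; apply: ltnW.
  by rewrite -[(_ * _)%coq_nat]/(_ * _)%N; apply: ltn_ceil.
split.
  apply: (Rmult_le_reg_r (INR N)) => //.
  have -> : (/ INR d - / INR N) * INR N = INR N / INR d - 1 by field; lra.
  have -> : INR (N %/ d) / INR N * INR N = INR (N %/ d) by field; lra.
  suff : INR N / INR d <= INR (N %/ d) + 1 by lra.
  apply: (Rmult_le_reg_r (INR d)) => //.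
  by have -> : INR N / INR d * INR d = INR N by field; lra.
apply: (Rmult_le_reg_r (INR N)) => //.
have -> : INR (N %/ d) / INR N * INR N = INR (N %/ d) by field; lra.
by rewrite Rmult_comm.
Qed.

Lemma has_mean_divn f m d : (0 < d)%N -> has_mean f m ->
  is_lim_seq (fun N => psum f (N %/ d) / INR N) (m / INR d).
Proof.
move=> d0 fm.
apply: (is_lim_seq_ext (fun N => mean f (N %/ d) * (INR (N %/ d) / INR N))).
  (* For N < d the sum is empty and both sides are 0, whatever the value of the quotient by 0. *)
  move=> N; rewrite /mean; case: (posnP (N %/ d)) => [->|q0]; first by rewrite /=; lra.
  have NR : 0 < INR N by apply: INR_pos; apply: leq_trans q0 (leq_div _ _).
  by have := INR_pos _ q0; move=> h; field; lra.
apply: is_lim_seq_mult'; last exact: is_lim_seq_divn.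
apply: (is_lim_seq_subseq (mean f) m (fun N => N %/ d)) => //.
move=> P [M HM]; exists (d * M)%N => N hN; apply: HM; apply/leP.
by rewrite leq_divRL // mulnC; apply/leP.
Qed.

Lemma is_lim_seq_scal_geom c q : 0 <= q < 1 -> is_lim_seq (fun K => c * q ^ K) 0.
Proof.
move=> q1; have -> : Rbar.Finite 0 = Rbar_mult c 0 by rewrite /= Rmult_0_r.
by apply: is_lim_seq_scal_l; apply: is_lim_seq_geom; rewrite Rabs_right; lra.
Qed.

Lemma ex_series_bounded_geom (b : nat -> R) B q : 0 <= q < 1 ->
  (forall k, Rabs (b k) <= B) -> ex_series (fun k => q ^ k * b k).
Proof.
move=> q1 bB; apply: (@ex_series_le _ _ _ (fun k => B * q ^ k)).
  move=> k; rewrite /norm /= /abs /= Rabs_mult (Rabs_right (q ^ k)); last first.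
    by apply: Rle_ge; apply: pow_le; lra.
  by rewrite Rmult_comm; apply: Rmult_le_compat_r => //; apply: pow_le; lra.
apply: (ex_series_scal_l (V := R_NormedModule) B).
by apply: ex_series_geom; rewrite Rabs_right; lra.
Qed.

(** By invariance, the n <= N divisible by p^k contribute psum f (N/p^k) to the sum of [f], so those
    of valuation exactly k - 1 contribute a difference of two such sums. The last term collects the
    valuations at least K. *)
Lemma psum_valuation p (b f : nat -> R) K N : prime p ->
  (forall n, (0 < n)%N -> f (p * n)%N = f n) ->
  psum (fun n => b (logn p n) * f n) N =
    psum (fun k => b k.-1 * (psum f (N %/ p ^ k.-1) - psum f (N %/ p ^ k))) K
    + psum (fun n => b (logn p n + K)%N * f n) (N %/ p ^ K).
Proof.
move=> pp fp; have p0 := prime_gt0 pp.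
(* Splitting off the multiples of [p]. *)
have step b' N' : psum (fun n => b' (logn p n) * f n) N' =
    b' 0%N * (psum f N' - psum f (N' %/ p))
    + psum (fun n => b' (logn p n).+1 * f n) (N' %/ p).
  have -> : psum f (N' %/ p) = psum (fun n => if p %| n then f n else 0) N'.
    rewrite psum_multiples //; apply: psum_ext => k hk; rewrite fp //.
    by case/andP: hk.
  have -> : psum (fun n => b' (logn p n).+1 * f n) (N' %/ p) =
            psum (fun n => if p %| n then b' (logn p n) * f n else 0) N'.
    rewrite (psum_multiples (fun n => b' (logn p n) * f n)) //.
    apply: psum_ext => k /andP [k0 _].
    by rewrite fp // lognM // (logn_prime p pp) eqxx add1n.
  rewrite -psum_minus -psum_scal -psum_plus; apply: psum_ext => k /andP [k0 _].
  case: ifP => pk; first ring.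
  by rewrite logn_not_dvd ?pk //; ring.
elim: K b N => [|K IH] b N.
  rewrite expn0 divn1 /= Rplus_0_l; apply: psum_ext => k _; by rewrite addn0.
rewrite step (IH (fun k => b k.+1)) psum_shift /= expn0 divn1 expn1 -divnMA -expnS.
rewrite Rplus_assoc; congr (_ + (_ + _)).
  apply: psum_ext => k /andP [k0 _]; rewrite prednK // -!divnMA -!expnS prednK //.
by apply: psum_ext => k _; rewrite addnS.
Qed.

(** In [psum_valuation] divided by N, the last term is at most B C p^(-K) uniformly in N, and for
    fixed K the other terms converge by [has_mean_divn]; [moore_osgood] concludes. *)
Lemma has_mean_valuation p (b f : nat -> R) (B C m : R) : prime p ->
  (forall n, (0 < n)%N -> f (p * n)%N = f n) ->
  (forall n, Rabs (f n) <= C) -> (forall k, Rabs (b k) <= B) -> has_mean f m ->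
  has_mean (fun n => b (logn p n) * f n)
    (m * ((1 - / INR p) * Series (fun k => / INR p ^ k * b k))).
Proof.
move=> pp fp fC bB fm; have p0 := prime_gt0 pp.
have p2 : 2 <= INR p by apply: (INR_leq 2); apply: prime_gt1.
have ip : 0 < / INR p by apply: Rinv_0_lt_compat; lra.
have ip1 : / INR p <= / 2 by apply: Rinv_le_contravar; lra.
have pkR k : 0 < INR p ^ k by apply: pow_lt; lra.
have B0 : 0 <= B by apply: Rle_trans (bB 0%N); apply: Rabs_pos.
have C0 : 0 <= C by apply: Rle_trans (fC 0%N); apply: Rabs_pos.
pose w K N := psum (fun k => b k.-1 *
   (psum f (N %/ p ^ k.-1) / INR N - psum f (N %/ p ^ k) / INR N)) K.
pose v K := psum (fun k => m * (1 - / INR p) * (/ INR p ^ k.-1 * b k.-1)) K.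
have [] := moore_osgood (mean (fun n => b (logn p n) * f n)) w v
  (fun K => B * C * (/ INR p) ^ K).
- move=> K N; rewrite /mean (psum_valuation p b f K N pp fp).
  have -> : w K N = psum (fun k => b k.-1 * (psum f (N %/ p ^ k.-1) - psum f (N %/ p ^ k))) K / INR N.
    rewrite /Rdiv Rmult_comm -psum_scal; apply: psum_ext => k _; rewrite /Rdiv; ring.
  rewrite /Rdiv -Rmult_minus_distr_r Rplus_minus_l Rabs_mult.
  case: (posnP N) => [->|N0].
    rewrite /= Rinv_0 Rabs_R0 Rmult_0_r; apply: Rmult_le_pos; first nra.
    by apply: pow_le; lra.
  have NR := INR_pos _ N0.
  rewrite (Rabs_right (/ INR N)); last first.
    by apply: Rle_ge; apply: Rlt_le; apply: Rinv_0_lt_compat.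
  apply: (Rmult_le_reg_r (INR N)) => //; rewrite Rmult_assoc Rinv_l; last lra.
  rewrite Rmult_1_r; apply: Rle_trans (psum_abs _ (B * C) _ _) _.
    by move=> k _; rewrite Rabs_mult; apply: Rmult_le_compat => //; apply: Rabs_pos.
  rewrite [X in _ <= X]Rmult_assoc; apply: Rmult_le_compat_l; first nra.
  have := INR_divn_le N (p ^ K) ltac:(by rewrite expn_gt0 p0).
  by rewrite INR_expn pow_inv /Rdiv Rmult_comm.
- by apply: is_lim_seq_scal_geom; lra.
- move=> K; apply: is_lim_seq_psum => k k0.
  have -> : m * (1 - / INR p) * (/ INR p ^ k.-1 * b k.-1) =
    b k.-1 * (m / INR (p ^ k.-1) - m / INR (p ^ k)).
    have E : INR p ^ k = INR p * INR p ^ k.-1 by rewrite tech_pow_Rmult prednK.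
    by rewrite !INR_expn E; have h := pkR k.-1; field; lra.
  apply: is_lim_seq_mult'; first exact: is_lim_seq_const.
  by apply: is_lim_seq_minus'; apply: has_mean_divn => //; rewrite expn_gt0 p0.
move=> V [h1 h2].
have := Series_psum (fun k => m * (1 - / INR p) * (/ INR p ^ k * b k)) V h1.
by rewrite Series_scal_l -Rmult_assoc => ->.
Qed.

(** * Means of the logarithm and of the negative powers *)

Lemma is_primeP p : reflect (is_prime p) (prime p).
Proof.
apply: (iffP idP) => [pp|].
  apply/prime_alt; split; first by have := prime_gt1 pp; lia.
  move=> n hn [a ha].
  have : Z.to_nat n %| p by apply/dvdnP; exists (Z.to_nat a); nia.
  by move/primeP: pp => [_ H] /H /orP [] /eqP; lia.
move=> pp; have p1 : (1 < p)%N by case: pp; lia.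
apply/primeP; split => // d /dvdnP [k Ek].
have : (Z.of_nat d | Z.of_nat p)%Z by exists (Z.of_nat k); rewrite Ek; lia.
move=> /(prime_divisors _ pp) H.
by case: H => [|[|[]]] H; apply/orP; [lia|left; apply/eqP; lia|right; apply/eqP; lia|lia].
Qed.

Lemma if_is_prime_dec p (x y : R) :
  match is_prime_dec p with left _ => x | right _ => y end = if prime p then x else y.
Proof. by case: is_prime_dec => h; case: is_primeP. Qed.

(* [logn p (2 * n) = logn p n + (p == 2)], so the factor [2] only shifts the
   valuation at [2]. *)
Lemma lfac_even p n : prime p -> (0 < n)%N ->
  lfac p (2 * n) = ln (geom p (logn p n + (p == 2%N))).
Proof.
by move=> pp n0; rewrite /lfac lognM // (logn_prime p (isT : prime 2)) addnC.
Qed.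

(** At 2 the valuation of 2n is one more than that of n. Reindexing the series by this shift doubles
    [alpha 2], which is the origin of the separate term [alpha 2] in [lambda]. *)
Definition local_log_mean (p : nat) : R :=
  if prime p then if p == 2%N then 2 * alpha 2 else alpha p else 0.

Lemma inv_INR_prime p : prime p -> 0 <= / INR p < 1.
Proof.
move=> /prime_gt1 p1; have : 2 <= INR p by apply: (INR_leq 2).
move=> h; split; first by apply: Rlt_le; apply: Rinv_0_lt_compat; lra.
by rewrite -Rinv_1; apply: Rinv_lt_contravar; lra.
Qed.

Lemma ex_series_inv_pow (p : nat) (b : nat -> R) B : prime p -> (forall k, Rabs (b k) <= B) ->
  ex_series (fun k => / INR p ^ k * b k).
Proof.
move=> pp bB.
apply: (ex_series_ext (fun k => (/ INR p) ^ k * b k)).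
  by move=> k; rewrite pow_inv.
by apply: ex_series_bounded_geom bB; apply: inv_INR_prime.
Qed.

Lemma INR2 : INR 2 = 2.
Proof. by []. Qed.

Lemma has_mean_lfac p : has_mean (fun n => lfac p (2 * n)) (local_log_mean p).
Proof.
rewrite /local_log_mean; case pp: (prime p); last first.
  apply: has_mean_ext (has_mean_cst 0) => n _.
  by rewrite lfac_nonprime ?pp.
have p1 := prime_gt1 pp.
pose b k := ln (geom p (k + (p == 2%N))).
have ln1 k : Rabs (ln (geom p k)) <= 1.
  have h1 := ln_geom_le p k p1; have h2 := geom_ge1 p k (ltnW p1).
  have h3 : 0 <= ln (geom p k) by rewrite -ln_1; apply: ln_le; lra.
  have p2 : 2 <= INR p by apply: (INR_leq 2).
  have : 2 / INR p <= 1.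
    by apply: (Rmult_le_reg_r (INR p)); [lra|rewrite /Rdiv Rmult_assoc Rinv_l; lra].
  by rewrite Rabs_right; lra.
have := has_mean_valuation p b (fun=> 1) 1 1 1 pp (fun _ _ => erefl) _ (fun k => ln1 _) (has_mean_cst 1).
move=> /(_ (fun n => ltac:(rewrite Rabs_R1; lra))).
rewrite Rmult_1_l => h.
have -> : (if p == 2%N then 2 * alpha 2 else alpha p) =
   (1 - / INR p) * Series (fun k => / INR p ^ k * b k).
  rewrite /b /alpha; case: eqP => [->|_].
    rewrite -Rmult_assoc (Rmult_comm 2) Rmult_assoc; congr (_ * _).
    rewrite -Series_scal_l; apply: Series_ext => k; rewrite addn1.
    by rewrite -tech_pow_Rmult INR2; have := pow_lt 2 k ltac:(lra); move=> ?; field; lra.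
  (* The term of valuation 0 is log 1 = 0, and [alpha] starts at valuation 1. *)
  congr (_ * _); rewrite [RHS]Series_incr_1; last first.
    by apply: (ex_series_inv_pow p _ 1 pp) => k; rewrite addn0.
  rewrite add0n geom0 ln_1 Rmult_0_r Rplus_0_l.
  by apply: Series_ext => k; rewrite addn0.
apply: has_mean_ext h => n n0.
by rewrite Rmult_1_r lfac_even.
Qed.

Lemma mean_lfac_tail K N : (0 < K)%N -> (0 < N)%N ->
  psum (fun n => ln (abund (2 * n)%N) - psum (fun p => lfac p (2 * n)) K) N <= 4 / INR K * INR N.
Proof.
move=> K0 N0.
apply: (Rle_trans _ (2 * 2 / INR K * INR N)); last by apply: Req_le; rewrite /Rdiv; ring.
apply: Rle_trans (mean_tail_le 2 K (2 * N) N ltac:(lra) K0 N0).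
apply: psum_le => n hn.
rewrite (ln_abund _ (K + 2 * N)); last lia.
rewrite psum_add Rplus_minus_l; apply: psum_le => k hk.
by apply: lfac_le; lia.
Qed.

Lemma lfac_sum_le K n : (0 < n)%N -> psum (fun p => lfac p (2 * n)) K <= ln (abund (2 * n)%N).
Proof.
move=> n0; rewrite (ln_abund _ (K + 2 * n)); last lia.
by apply: psum_mono; [move=> k; apply: lfac_ge0|lia].
Qed.

Lemma mean_minus f g N : mean f N - mean g N = mean (fun n => f n - g n) N.
Proof. by rewrite /mean psum_minus /Rdiv; ring. Qed.

Lemma mean_abs_le f c N : 0 <= c ->
  ((0 < N)%N -> psum (fun n => Rabs (f n)) N <= c * INR N) -> Rabs (mean f N) <= c.
Proof.
move=> c0 H; case: (posnP N) => [->|N0].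
  by rewrite /mean /Rdiv /= Rmult_0_l Rabs_R0.
have NR := INR_pos _ N0.
rewrite /mean /Rdiv Rabs_mult (Rabs_right (/ INR N)); last first.
  by apply: Rle_ge; apply: Rlt_le; apply: Rinv_0_lt_compat.
apply: (Rmult_le_reg_r (INR N)) => //; rewrite Rmult_assoc Rinv_l ?Rmult_1_r; last lra.
by apply: Rle_trans (psum_abs_le _ _) _; apply: H.
Qed.

Lemma is_lim_seq_inv_S c : is_lim_seq (fun K => c / INR K.+1) 0.
Proof.
have -> : Rbar.Finite 0 = Rbar_mult c 0 by rewrite /= Rmult_0_r.
apply: is_lim_seq_scal_l.
apply: (proj1 (is_lim_seq_incr_1 (fun K => / INR K) 0)).
by apply: (is_lim_seq_inv INR p_infty) => //; apply: is_lim_seq_INR.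
Qed.

Lemma has_mean_ln_abund : has_mean (fun n => ln (abund (2 * n)%N)) (alpha 2 + prime_sum alpha).
Proof.
have [] := moore_osgood (mean (fun n => ln (abund (2 * n)%N)))
  (fun K => mean (fun n => psum (fun p => lfac p (2 * n)) K.+1))
  (fun K => psum local_log_mean K.+1) (fun K => 4 / INR K.+1).
- move=> K N; rewrite mean_minus; apply: mean_abs_le.
    by apply: Rlt_le; apply: Rdiv_lt_0_compat; [lra|apply: INR_pos].
  move=> N0; apply: Rle_trans (mean_lfac_tail K.+1 N isT N0).
  apply: Req_le; apply: psum_ext => n /andP [n0 _]; apply: Rabs_right.
  by have := lfac_sum_le K.+1 n n0; lra.
- exact: is_lim_seq_inv_S.
- move=> K; apply: (is_lim_seq_ext (fun N => psum (fun p => mean (fun n => lfac p (2 * n)) N) K.+1)).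
    move=> N; rewrite /mean [RHS]/Rdiv psum_exchange Rmult_comm -psum_scal.
    by apply: psum_ext => p _; rewrite /Rdiv Rmult_comm.
  by apply: is_lim_seq_psum => p _; apply: has_mean_lfac.
move=> V [h1 h2]; suff -> : alpha 2 + prime_sum alpha = V by [].
suff : prime_sum alpha = V - alpha 2 by lra.
apply: is_lim_seq_Series.
(* From index 2 on, both partial sums contain the prime 2 and differ by exactly one [alpha 2]. *)
apply/(is_lim_seq_incr_n _ 2).
apply: (is_lim_seq_ext (fun K => psum local_log_mean K.+2 - alpha 2)).
  move=> K; rewrite -[(K + 2)%coq_nat]/(K + 2)%N addn2; elim: K => [|K IH].
    rewrite sum_Sn sum_Sn sum_O /plus /=.
    by rewrite !if_is_prime_dec /local_log_mean /=; ring.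
  rewrite sum_Sn -IH if_is_prime_dec.
  have -> : psum local_log_mean K.+3 = psum local_log_mean K.+2 +
    (if prime K.+3 then alpha K.+3 else 0) by [].
  by move: (psum _ K.+2) (if _ then _ else _) => x y; rewrite /plus /=; ring.
apply: is_lim_seq_minus'; last exact: is_lim_seq_const.
by move/is_lim_seq_incr_1: h1.
Qed.

(** At 2 the series runs over valuations m >= 1 of 2n: it is the sum of 2^(-m) g_m^(-j), where g_m =
    [geom 2 m]. Since [beta j 2] is half of that sum plus half of the term 1 at m = 0, the value is
    [2 * beta j 2 - 1]. *)
Definition local_pow_mean (j p : nat) : R :=
  if prime p then if p == 2%N then 2 * beta j 2 - 1 else beta j p else 1.

Fixpoint pprod (f : nat -> R) (n : nat) : R :=
  match n with O => 1 | S k => pprod f k * f (S k) end.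

Lemma exp_neg_le1 j x : 0 <= x -> exp (- INR j * x) <= 1.
Proof.
move=> x0; rewrite -exp_0; have := pos_INR j => j0.
have : - INR j * x <= 0 by nra.
by case => [/exp_increasing|->]; lra.
Qed.

Lemma exp_neg_ln j x : 0 < x -> exp (- INR j * ln x) = / x ^ j.
Proof.
move=> x0; rewrite Ropp_mult_distr_l_reverse exp_Ropp -[X in / X]/(Rpower x (INR j)).
by rewrite Rpower_pow.
Qed.

Lemma inv_pow_geom_bound p k j : (0 < p)%N -> Rabs (/ geom p k ^ j) <= 1.
Proof.
move=> /(geom_ge1 p k) h; have := pow_R1_Rle _ j h => h1.
rewrite Rabs_right; last by apply: Rle_ge; apply: Rlt_le; apply: Rinv_0_lt_compat; lra.
by rewrite -[X in _ <= X]Rinv_1; apply: Rinv_le_contravar; lra.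
Qed.

Lemma local_pow_meanE j p : prime p ->
  local_pow_mean j p =
    (1 - / INR p) * Series (fun k => / INR p ^ k * / geom p (k + (p == 2%N)) ^ j).
Proof.
move=> pp; rewrite /local_pow_mean pp; case: eqP => [->|_]; last first.
  by rewrite /beta; congr (_ * _); apply: Series_ext => k; rewrite addn0.
rewrite /beta Series_incr_1; last first.
  by apply: (ex_series_inv_pow 2 _ 1) => // k; apply: inv_pow_geom_bound.
rewrite geom0 pow1 INR2.
have -> : Series (fun k => / 2 ^ k.+1 * / geom 2 k.+1 ^ j) =
   / 2 * Series (fun k => / 2 ^ k * / geom 2 (k + true) ^ j).
  rewrite -Series_scal_l; apply: Series_ext => k.
  by rewrite addn1 -tech_pow_Rmult Rinv_mult; ring.
by rewrite /=; field.
Qed.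

(** Induction on K: for a prime q = K + 1 the new factor depends only on the valuation at q, and the
    earlier factors are invariant under n -> q n, so [has_mean_valuation] multiplies the mean by the
    local one. *)
Lemma has_mean_pow_trunc j K :
  has_mean (fun n => exp (- INR j * psum (fun p => lfac p (2 * n)) K))
    (pprod (local_pow_mean j) K).
Proof.
elim: K => [|K IH].
  by apply: has_mean_ext (has_mean_cst 1) => n _; rewrite /= Rmult_0_r exp_0.
have expS n : exp (- INR j * psum (fun p => lfac p (2 * n)) K.+1) =
   exp (- INR j * lfac K.+1 (2 * n)) * exp (- INR j * psum (fun p => lfac p (2 * n)) K).
  by rewrite -exp_plus; congr exp; rewrite /psum -/psum; ring.
rewrite [pprod _ _]/=; case pp: (prime K.+1); last first.
  rewrite /local_pow_mean pp Rmult_1_r; apply: has_mean_ext IH => n _.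
  by rewrite expS lfac_nonprime ?pp // Rmult_0_r exp_0 Rmult_1_l.
rewrite local_pow_meanE //.
pose b k := / geom K.+1 (k + (K.+1 == 2%N)) ^ j.
apply: (has_mean_ext (fun n => b (logn K.+1 n) * exp (- INR j * psum (fun p => lfac p (2 * n)) K))).
  move=> n n0; rewrite expS lfac_even // exp_neg_ln //.
  by have := geom_ge1 K.+1 (logn K.+1 n + (K.+1 == 2%N)) isT; lra.
apply: (has_mean_valuation K.+1 b _ 1 1) => //.
- move=> n n0; congr (exp (_ * _)); apply: psum_ext => p hp.
  rewrite /lfac; congr (ln (geom p _)).
  case p1: (prime p); last by rewrite !logn_nonprime ?p1.
  rewrite mulnCA (lognM p (m := K.+1)) ?muln_gt0 // (@logn_prime p K.+1) //.
  by have -> : (p == K.+1) = false by lia.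
- move=> n; rewrite Rabs_right; last by apply: Rle_ge; apply: Rlt_le; apply: exp_pos.
  by apply: exp_neg_le1; apply: psum_ge0 => k; apply: lfac_ge0.
by move=> k; apply: inv_pow_geom_bound.
Qed.

(** Transfers the tail bound for log h to h^(-j) at the price of a factor j, harmless as j is fixed
    when K grows. *)
Lemma exp_neg_lipschitz j x y : 0 <= x -> x <= y ->
  Rabs (exp (- INR j * y) - exp (- INR j * x)) <= INR j * (y - x).
Proof.
move=> x0 xy; have j0 := pos_INR j.
have -> : exp (- INR j * y) = exp (- INR j * x) * exp (- INR j * (y - x)).
  by rewrite -exp_plus; congr exp; ring.
have h1 := exp_neg_le1 j x x0.
have h2 := exp_pos (- INR j * x).
have h3 := exp_ineq1_le (- INR j * (y - x)).
have h4 := exp_neg_le1 j (y - x) ltac:(lra).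
rewrite Rabs_left1; nra.
Qed.

Lemma pprod_odd_prime_prod j K :
  pprod (local_pow_mean j) K.+2 = (2 * beta j 2 - 1) * odd_prime_prod (beta j) K.+2.
Proof.
elim: K => [|K IH].
  by rewrite /= /local_pow_mean /= !if_is_prime_dec /=; ring.
rewrite -[pprod _ K.+3]/(pprod (local_pow_mean j) K.+2 * local_pow_mean j K.+3) IH Rmult_assoc.
congr (_ * _).
rewrite -[odd_prime_prod _ K.+3]/(odd_prime_prod (beta j) K.+2 *
  match is_prime_dec K.+3 with left _ => beta j K.+3 | right _ => 1 end).
by rewrite if_is_prime_dec.
Qed.

(** True for infinite [l] too, because [real] sends both infinities to 0. It moves the factor at 2
    inside the limit defining [odd_prime_product], instead of dividing by it. *)
Lemma real_Rbar_mult_l (a : R) (l : Rbar) : real (Rbar_mult a l) = a * real l.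
Proof.
case: l => [l||] /=; first by [].
- by case: Rle_dec => [h|h] /=; [case: Rle_lt_or_eq_dec => /= *; ring|ring].
by case: Rle_dec => [h|h] /=; [case: Rle_lt_or_eq_dec => /= *; ring|ring].
Qed.

Lemma has_mean_pow_abund j :
  has_mean (fun n => exp (- INR j * ln (abund (2 * n)%N)))
    ((2 * beta j 2 - 1) * odd_prime_product (beta j)).
Proof.
have j0 := pos_INR j.
have [] := moore_osgood (mean (fun n => exp (- INR j * ln (abund (2 * n)%N))))
  (fun K => mean (fun n => exp (- INR j * psum (fun p => lfac p (2 * n)) K.+1)))
  (fun K => pprod (local_pow_mean j) K.+1) (fun K => INR j * 4 / INR K.+1).
- move=> K N; have K0 := INR_pos K.+1 isT.
  rewrite mean_minus; apply: mean_abs_le.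
    by apply: Rmult_le_pos; [lra|apply: Rlt_le; apply: Rinv_0_lt_compat].
  move=> N0.
  have -> : INR j * 4 / INR K.+1 * INR N = INR j * (4 / INR K.+1 * INR N) by field; lra.
  apply: Rle_trans (Rmult_le_compat_l _ _ _ j0 (mean_lfac_tail K.+1 N isT N0)).
  rewrite -psum_scal; apply: psum_le => n /andP [n0 _].
  apply: exp_neg_lipschitz; last exact: lfac_sum_le.
  by apply: psum_ge0 => k; apply: lfac_ge0.
- exact: is_lim_seq_inv_S.
- by move=> K; apply: has_mean_pow_trunc.
move=> V [/is_lim_seq_incr_1 h1 h2].
suff -> : (2 * beta j 2 - 1) * odd_prime_product (beta j) = V by [].
rewrite /odd_prime_product -real_Rbar_mult_l -Lim_seq_scal_l.
rewrite -[V]/(real (Rbar.Finite V)); congr real.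
apply: is_lim_seq_unique; apply/(is_lim_seq_incr_n _ 2).
apply: (is_lim_seq_ext (fun K => pprod (local_pow_mean j) K.+2)) h1 => K.
by rewrite -[(K + 2)%coq_nat]/(K + 2)%N addn2 pprod_odd_prime_prod.
Qed.

(** * The logarithmic series and the mean of log(h - 1) *)

Lemma is_derive_log_partial x J :
  is_derive (fun x => psum (fun j => x ^ j / INR j) J) x (psum (fun j => x ^ j.-1) J).
Proof.
elim: J => [|J IH]; first by apply: is_derive_const.
apply: is_derive_plus IH _.
evar_last; first by auto_derive.
have h := INR_pos J.+1 isT.
change (1 * (INR J.+1 * x ^ J) * / INR J.+1 = x ^ J); field; lra.
Qed.

Lemma psum_geom x J : (1 - x) * psum (fun j => x ^ j.-1) J = 1 - x ^ J.
Proof. by elim: J => [|J IH] /=; [|rewrite Rmult_plus_distr_l IH]; ring. Qed.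

(** The left side without the absolute value vanishes at 0 and has derivative -t^J/(1 - t), so the
    mean value theorem applies. The range of x is that of 1/h for h >= 3/2. *)
Lemma log_series_remainder x J : 0 <= x <= 2/3 ->
  Rabs (ln (1 - x) + psum (fun j => x ^ j / INR j) J) <= 3 * (2/3) ^ J.
Proof.
move=> hx.
pose f t := ln (1 - t) + psum (fun j => t ^ j / INR j) J.
have df t : t <= 2/3 -> is_derive f t (- (t ^ J / (1 - t))).
  move=> ht; have -> : - (t ^ J / (1 - t)) = - / (1 - t) + psum (fun j => t ^ j.-1) J.
    apply: (Rmult_eq_reg_l (1 - t)); last lra.
    by rewrite Rmult_plus_distr_l psum_geom; field; lra.
  apply: (is_derive_plus (K := R_AbsRing) (V := R_NormedModule)).
    by auto_derive; [lra|field; lra].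
  exact: is_derive_log_partial.
have mM : Rmin 0 x = 0 /\ Rmax 0 x = x by rewrite Rmin_left ?Rmax_right; lra.
have [] := MVT_gen f 0 x (fun t => - (t ^ J / (1 - t))).
- by case: mM => -> -> t ht; apply: df; lra.
- case: mM => -> -> t ht; apply/continuity_pt_filterlim.
  by apply: (ex_derive_continuous f t); exists (- (t ^ J / (1 - t))); apply: df; lra.
case: mM => -> -> c [hc E].
have f0 : f 0 = 0.
  rewrite /f Rminus_0_r ln_1 Rplus_0_l (psum_ext _ (fun=> 0)) ?psum_zero // => k hk.
  by rewrite pow_i ?/Rdiv ?Rmult_0_l //; lia.
rewrite -[X in Rabs X]/(f x) -[f x]Rminus_0_r -f0 E Rminus_0_r.
have cJ : 0 <= c ^ J <= (2/3) ^ J.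
  by split; [apply: pow_le; lra|apply: pow_incr; lra].
have ic : 0 < / (1 - c) <= 3.
  split; first by apply: Rinv_0_lt_compat; lra.
  have -> : 3 = / (1/3) by field.
  by apply: Rinv_le_contravar; lra.
rewrite Rabs_mult Rabs_Ropp (Rabs_right x); last lra.
rewrite Rabs_right; last by apply: Rle_ge; apply: Rmult_le_pos; lra.
apply: (Rle_trans _ (c ^ J / (1 - c) * 1)).
  by apply: Rmult_le_compat_l; [apply: Rmult_le_pos|]; lra.
rewrite Rmult_1_r /Rdiv Rmult_comm; apply: Rmult_le_compat; lra.
Qed.

Lemma has_mean_ln_abund_minus1 : has_mean (fun n => ln (abund (2 * n)%N - 1)) lambda.
Proof.
pose G j n := exp (- INR j * ln (abund (2 * n)%N)).
pose B j := (2 * beta j 2 - 1) * odd_prime_product (beta j).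
pose L0 := alpha 2 + prime_sum alpha.
have [] := moore_osgood (mean (fun n => ln (abund (2 * n)%N - 1)))
  (fun J N => mean (fun n => ln (abund (2 * n)%N)) N - psum (fun j => / INR j * mean (G j) N) J)
  (fun J => L0 - psum (fun j => / INR j * B j) J) (fun J => 3 * (2/3) ^ J).
- move=> J N.
  have -> : psum (fun j => / INR j * mean (G j) N) J =
            mean (fun n => psum (fun j => / INR j * G j n) J) N.
    rewrite /mean psum_exchange /Rdiv Rmult_comm -psum_scal; apply: psum_ext => j _.
    by rewrite psum_scal; ring.
  rewrite !mean_minus; apply: mean_abs_le.
    by apply: Rmult_le_pos; [lra|apply: pow_le; lra].
  move=> N0; rewrite -psum_const; apply: psum_le => n /andP [n0 _].
  have h := abund_even_ge n n0.
  have hx : 0 <= / abund (2 * n) <= 2 / 3.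
    split; first by apply: Rlt_le; apply: Rinv_0_lt_compat; lra.
    have -> : 2/3 = / (3/2) by field.
    by apply: Rinv_le_contravar; lra.
  have -> : ln (abund (2 * n) - 1) = ln (abund (2 * n)) + ln (1 - / abund (2 * n)).
    by rewrite -ln_mult; [congr ln; field; lra|lra|lra].
  apply: Rle_trans (log_series_remainder (/ abund (2 * n)) J hx); apply: Req_le.
  congr Rabs; rewrite (psum_ext _ (fun j => (/ abund (2 * n)) ^ j / INR j)); first ring.
  by move=> j _; rewrite /G exp_neg_ln ?pow_inv /Rdiv; [rewrite Rmult_comm|lra].
- by apply: is_lim_seq_scal_geom; lra.
- move=> J; apply: is_lim_seq_minus'; first exact: has_mean_ln_abund.
  apply: is_lim_seq_psum => j _; apply: is_lim_seq_mult'; first exact: is_lim_seq_const.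
  exact: has_mean_pow_abund.
move=> V [h1 h2]; suff -> : lambda = V by [].
rewrite /lambda -/L0.
rewrite (Series_psum _ (L0 - V)); first ring.
apply: (is_lim_seq_ext (fun J => L0 - (L0 - psum (fun j => / INR j * B j) J))).
  move=> J; rewrite (psum_ext (fun k => / INR k.-1.+1 * _) (fun j => / INR j * B j)); first ring.
  by move=> k /andP [k0 _]; rewrite prednK.
by apply: is_lim_seq_minus' => //; apply: is_lim_seq_const.
Qed.

(** * Choice of y and the final estimate *)

Lemma mean_ln_abund_error N : (256 <= N)%N ->
  Rabs (mean (fun n => ln (abund (2 * n)%N - 1)) N - lambda) <= 80 / ln (INR N).
Proof.
move=> N256; have N0 : (0 < N)%N by lia.
have NR := INR_pos _ N0.
(* Here y <= m < 2y. The base 16 = 2 * 2 * 4 gives y y L <= 2^y 2^y 4^y = 16^y <= N, while N <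
   16^(m+1) <= 2^(8y) gives log N <= 8y. N >= 256 = 16^2 ensures y >= 2. *)
pose m := trunc_log 16 N; pose t := trunc_log 2 m; pose y := (2 ^ t)%N.
have /andP [m1 m2] : (16 ^ m <= N < 16 ^ m.+1)%N by apply: trunc_log_bounds.
have m_ge : (2 <= m)%N by apply: trunc_log_max.
have /andP [t1 t2] : (2 ^ t <= m < 2 ^ t.+1)%N by apply: trunc_log_bounds; lia.
have t_ge : (1 <= t)%N by apply: trunc_log_max.
have y2 : (1 < y)%N by rewrite -[2%N]/(2 ^ 1)%N /y leq_exp2l.
have yR : 2 <= INR y by apply: (INR_leq 2).
have [L [/andP [L0 L1] HL]] := common_multiple t.
have [P HP] := mean_near_constant y L y2 L0 HL.
have lnN : 0 < ln (INR N).
  by rewrite -ln_1; apply: ln_increasing; [lra|apply: (lt_INR 1); lia].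
have lnN_le : ln (INR N) <= 8 * INR y.
  have h : INR N <= 2 ^ (8 * y).
    rewrite -INR2 -INR_expn; apply: INR_leq; apply: ltnW; apply: leq_trans m2 _.
    rewrite -[16%N]/(2 ^ 4)%N -expnM leq_exp2l //.
    by rewrite expnS -/y in t2; lia.
  have := ln_le _ _ NR h; rewrite ln_pow; last lra.
  rewrite mult_INR; have -> : INR 8 = 8 by simpl; ring.
  have := ln_le_minus1 2 ltac:(lra); nra.
have HyL : INR y * INR y * INR L <= INR N.
  rewrite -!mult_INR -[Nat.mul]/muln; apply: INR_leq; apply: leq_trans m1.
  apply: (@leq_trans (16 ^ y)%N); last by rewrite leq_exp2l.
  rewrite (_ : 16 ^ y = 2 ^ y * 2 ^ y * 4 ^ y)%N; last by rewrite -!expnMn.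
  by apply: leq_mul L1; apply: leq_mul; apply: ltnW; apply: ltn_expl.
(* The bound [HP] with y and L fixed and its integer tending to infinity. *)
have HlP : Rabs (lambda - P) <= 4 / INR y.
  apply: (is_lim_seq_le_loc (fun N => Rabs (mean (fun n => ln (abund (2 * n)%N - 1)) N - P))
    (fun N => 4 / INR y + 2 * INR y * INR L * / INR N) (Rabs (lambda - P)) (4 / INR y)).
  - by exists 1%N => M hM; apply: HP; lia.
  - apply: (is_lim_seq_abs _ _ (is_lim_seq_minus' _ _ _ _ has_mean_ln_abund_minus1 (is_lim_seq_const P))).
  rewrite -{2}[4 / INR y]Rplus_0_r -(Rmult_0_r (2 * INR y * INR L)).
  apply: is_lim_seq_plus'; first exact: is_lim_seq_const.
  apply: is_lim_seq_mult'; first exact: is_lim_seq_const.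
  by apply: (is_lim_seq_inv INR p_infty) => //; apply: is_lim_seq_INR.
have h1 := HP N N0.
have h2 : 2 * INR y * INR L / INR N <= 2 / INR y.
  apply: (Rmult_le_reg_r (INR N * INR y)); first nra.
  have -> : 2 * INR y * INR L / INR N * (INR N * INR y) = 2 * (INR y * INR y * INR L) by field; lra.
  have -> : 2 / INR y * (INR N * INR y) = 2 * INR N by field; lra.
  lra.
(* 10 = 4 + 2 + 4: the two terms of [HP] at N and the distance from [lambda] to [P]; then y >= log N
   / 8. *)
have h3 : 10 / INR y <= 80 / ln (INR N).
  apply: (Rmult_le_reg_r (INR y * ln (INR N))); first nra.
  have -> : 10 / INR y * (INR y * ln (INR N)) = 10 * ln (INR N) by field; lra.
  have -> : 80 / ln (INR N) * (INR y * ln (INR N)) = 80 * INR y by field; lra.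
  lra.
have -> : mean (fun n => ln (abund (2 * n)%N - 1)) N - lambda =
  (mean (fun n => ln (abund (2 * n)%N - 1)) N - P) - (lambda - P) by ring.
apply: Rle_trans h3; apply: Rle_trans (Rabs_triang _ _) _; rewrite Rabs_Ropp.
move: h1; rewrite -/(mean _ N).
have -> : 10 / INR y = 4 / INR y + 2 / INR y + 4 / INR y by rewrite /Rdiv; ring.
lra.
Qed.

Lemma avg_log_mean N : (0 < N)%N ->
  avg_log N = mean (fun n => ln (abund (2 * n)%N - 1)) N.
Proof.
move=> N0; rewrite /avg_log /mean Rmult_comm; congr (_ * _).
rewrite (psum_ext _ (fun n => ln (INR (s (2 * n)) / INR (2 * n)))); last first.
  by move=> n /andP [n0 _]; rewrite s_abund // muln_gt0.
(* [sum_f_R0] up to N - 1 has N terms because N >= 1. *)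
have -> : (N - 1)%coq_nat = N.-1 by lia.
rewrite -{2}(prednK N0); elim: N.-1 => [|K IH]; first by rewrite /= Rplus_0_l.
by rewrite tech5 IH.
Qed.

Lemma avg_log_error N : (256 <= N)%coq_nat ->
  Rabs (avg_log N - lambda) <= 80 / ln (INR N).
Proof.
move=> hN; rewrite avg_log_mean; last lia.
by apply: mean_ln_abund_error; lia.
Qed.

End MeanValues.

Theorem theorem3p3 :
  exists (C : R) (N0 : nat), forall N : nat, (N0 <= N)%nat ->
    Rabs (avg_log N - lambda) <= C / ln (INR N).
Proof.
exists 80, 256%nat; exact MeanValues.avg_log_error.
Qed.
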